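(* For all integers $n\geq 2$ and $h\geq 1$, $$f_{\leq h}^{n}=\sum_{t=0}^{n-1} f_{\leq h}^{t}\,f_{\leq h-1}^{n-1-t},$$ where $f_{\leq h}^0=1$ (for every $h \ge 0$).
   Context: All posets are finite. A semiorder is a poset with no induced subposet isomorphic to $\mathbf{2}+\mathbf{2}$ (disjoint union of two 2-element chains with no other comparabilities) or $\mathbf{3}+\mathbf{1}$ (disjoint union of a 3-element chain and a single incomparable element). Its length is the length of a longest chain (a chain with $\ell+1$ elements has length $\ell$). For $h\ge 0$ and $n\ge 0$, $f_{\leq h}^n$ denotes the number of nonisomorphic unlabeled semiorders with $n$ elements and length at most $h$; in particular $f_{\le h}^0=1$. *)

(* Defs.v *)
From mathcomp Require Export all_boot.
From mathcomp Require Export fingroup perm.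

Set Implicit Arguments.
Unset Strict Implicit.
Unset Printing Implicit Defensive.

Definition partial_order (T : finType) (le : rel T) : bool :=
  [&& [forall x, le x x],
      [forall x, forall y, le x y && le y x ==> (x == y)] &
      [forall x, forall y, forall z, le x y && le y z ==> le x z]].

(* [le] restricted to the image of [f] is isomorphic, via [f], to [leQ]. *)
Definition has_induced_subposet (Q T : finType) (leQ : rel Q) (le : rel T) : bool :=
  [exists f : {ffun Q -> T},
     injectiveb f && [forall a, forall b, leQ a b == le (f a) (f b)]].

Definition chain_le (k : nat) : rel 'I_k := fun i j => i <= j.

Definition disjoint_union_le (T1 T2 : finType) (r1 : rel T1) (r2 : rel T2) :
    rel (T1 + T2)%type :=
  fun u v => match u, v with
             | inl x, inl y => r1 x y
             | inr x, inr y => r2 x y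
             | _, _ => false
             end.

Definition semiorder (T : finType) (le : rel T) : bool :=
  [&& partial_order le,
      ~~ has_induced_subposet
           (disjoint_union_le (@chain_le 2) (@chain_le 2)) le &
      ~~ has_induced_subposet
           (disjoint_union_le (@chain_le 3) (@chain_le 1)) le].

Definition is_chain (T : finType) (le : rel T) (C : {set T}) : bool :=
  [forall x in C, forall y in C, le x y || le y x].

(* Because of the truncated predecessor the empty poset has length 0; with the
   convention -1 it would equally be counted among the posets of length at most
   h for every h >= 0. *)
Definition poset_length (T : finType) (le : rel T) : nat :=
  \max_(C : {set T} | is_chain le C) #|C|.-1.

Definition isomorphic (T : finType) (le1 le2 : rel T) : bool :=
  [exists s : {perm T}, forall x, forall y, le1 x y == le2 (s x) (s y)].

(* Sets of pairs make the relations on a finType into a finType. *)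
Definition rel_of (T : finType) (S : {set T * T}) : rel T :=
  fun x y => (x, y) \in S.

Definition semiorders_upto (h n : nat) : {set {set 'I_n * 'I_n}} :=
  [set S | semiorder (rel_of S) && (poset_length (rel_of S) <= h)].

(* The number of isomorphism classes of n-element semiorders of length at
   most h; every n-element poset is isomorphic to one with carrier 'I_n. *)
Definition num_semiorders (h n : nat) : nat :=
  #|equivalence_partition (fun S1 S2 => isomorphic (rel_of S1) (rel_of S2))
                          (semiorders_upto h n)|.

(* Main.v *)
(** Listing the elements of a semiorder by increasing down-sets and, within
    equal down-sets, decreasing up-sets turns it into [j < i in the poset iff
    j < g_i], where [g_i] is the size of the i-th down-set.  So isomorphism
    classes correspond to weakly increasing sequences [g] with [g_i <= i].
    Adding a virtual root 0 and shifting the elements to 1, ..., n, such a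
    sequence lists the parents of the nodes of a plane tree in breadth-first
    order, and the length of the semiorder is the height of the forest below
    the root.  Cutting off the first tree of a plane forest is the asserted
    recursion; in breadth-first order it is the statement that the number of
    ways to complete a partially built forest is multiplicative under
    splitting its unfinished nodes into two groups. *)

Require Import Defs.
From mathcomp Require Import zify.

Set Implicit Arguments.
Unset Strict Implicit.
Unset Printing Implicit Defensive.

(** * Breadth-first words and their convolution identity *)

(* The ways to complete a breadth-first parent list when [a] nodes of the
   current level and [b] nodes of the next level await their children, [m]
   nodes are still to come and [h] further levels are allowed.  Entries count
   from the first waiting node; either it gets a child (entry 0) or it is
   finished (the remaining entries are renumbered). *)
Fixpoint words (h : nat) : nat -> nat -> nat -> seq (seq nat) :=
  match h with
  | 0 => fun a b m => if (b == 0) && (m == 0) then [:: [::]] else [::]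
  | h'.+1 => fix words_size a b m {struct m} :=
      match m with
      | 0 => [:: [::]]
      | m'.+1 =>
        (fix words_level a {struct a} :=
           match a with
           | 0 => words h' b 0 m'.+1
           | a'.+1 => [seq 0 :: s | s <- words_size a'.+1 b.+1 m']
                      ++ [seq [seq v.+1 | v <- s] | s <- words_level a']
           end) a
      end
  end.

Lemma wordsS0 h b m : words h.+1 0 b m = words h b 0 m.
Proof. by case: m => [|m] //; case: h. Qed.

Lemma wordsSS h a b m :
  words h.+1 a.+1 b m.+1 = [seq 0 :: s | s <- words h.+1 a.+1 b.+1 m]
    ++ [seq [seq v.+1 | v <- s] | s <- words h.+1 a b m.+1].
Proof. by []. Qed.

Lemma size_wordsSS h a b m :
  size (words h.+1 a.+1 b m.+1)
  = size (words h.+1 a.+1 b.+1 m) + size (words h.+1 a b m.+1).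
Proof. by rewrite wordsSS size_cat !size_map. Qed.

(** The [t] nodes placed below the first group of waiting nodes and those placed below the second
    are arranged independently. The induction follows the recursion of [words], treating the current
    level of the first group before that of the second. *)
Lemma size_words_conv h a1 a2 b1 b2 m :
  size (words h (a1 + a2) (b1 + b2) m)
  = \sum_(t < m.+1) size (words h a1 b1 t) * size (words h a2 b2 (m - t)).
Proof.
elim: h a1 a2 b1 b2 m => [|h IHh] a1 a2 b1 b2 m.
  rewrite big_ord_recl big1 => [|[t lt_tm] _] /=; last by rewrite /bump andbF.
  by rewrite subn0; case: b1; case: b2 => [|b2]; case: m.
elim: m a1 a2 b1 b2 => [|m IHm] a1 a2 b1 b2; first by rewrite big_ord1.
elim: a1 => [|a1 IHa1].
  elim: a2 => [|a2 IHa2].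
    by rewrite wordsS0 (IHh b1 b2 0 0); apply: eq_bigr => t _; rewrite !wordsS0.
  (* The waiting node treated here belongs to the second group. The last summand leaves no new node
     for that group, so it is split off before the second factor is unfolded. *)
  rewrite add0n size_wordsSS -addnS (IHm 0 a2.+1) IHa2 [in RHS]big_ord_recr.
  rewrite [X in _ + X]big_ord_recr /= addnA subnn; congr (_ + _ * _).
  rewrite -big_split /=; apply: eq_bigr => -[t lt_tm] _ /=.
  by rewrite subSn // size_wordsSS mulnDr.
rewrite addSn size_wordsSS -addSn IHa1 -addSn IHm [in RHS]big_ord_recl.
rewrite [X in _ + X]big_ord_recl /= addnCA; congr (_ + _).
by rewrite -big_split; apply: eq_bigr => t _; rewrite size_wordsSS mulnDl.
Qed.

(** * Description of the words by inequalities *)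

Fixpoint bounded (c : nat) (s : seq nat) : bool :=
  if s is v :: s' then (v < c) && bounded c.+1 s' else true.

Lemma boundedP c s :
  reflect (forall i, i < size s -> nth 0 s i < c + i) (bounded c s).
Proof.
elim: s c => [|v s IHs] c /=; first by constructor.
apply: (iffP andP) => [[lt_vc /IHs lt_s] [|i] //= | lt_s].
- by rewrite addn0.
- by rewrite addnS -addSn; apply: lt_s.
- split; first by have := lt_s 0 isT; rewrite addn0.
  by apply/IHs => i lt_i; rewrite addSn -addnS; apply: (lt_s i.+1).
Qed.

(* [e |-> a + b + #{v < e}] maps the number of nodes up to the end of a level
   to the number of nodes up to the end of the next one. *)
Definition admissible h a b m s :=
  [&& size s == m, sorted leq s, bounded (a + b) s &
      iter h (fun e => a + b + count (fun v => v < e) s) a == a + b + m].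

Lemma bounded_succ c s : bounded c.+1 [seq v.+1 | v <- s] = bounded c s.
Proof. by elim: s c => //= v s IHs c; rewrite IHs. Qed.

Lemma sorted_succ s : sorted leq [seq v.+1 | v <- s] = sorted leq s.
Proof. by rewrite sorted_map. Qed.

Lemma iter_semiconj (T U : Type) (f : T -> T) (g : U -> U) (k : U -> T) n x :
  (forall y, f (k y) = k (g y)) -> iter n f (k x) = k (iter n g x).
Proof. by move=> fk; elim: n => //= n ->. Qed.

(** One finished node in front shifts all positions by one, so the level-end maps are conjugate
    under the successor. *)
Lemma admissible_succ h a b m s :
  admissible h a.+1 b m [seq v.+1 | v <- s] = admissible h a b m s.
Proof.
rewrite /admissible size_map sorted_succ !addSn bounded_succ.
rewrite (@iter_semiconj _ _ _ (fun e => a + b + count (fun v => v < e) s)) //.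
by move=> e; rewrite count_map.
Qed.

(** An entry 0 lies below every positive level end, so the two level-end maps differ only at 0,
    which the iteration from [a.+1] never visits. *)
Lemma admissible_cons0 h a b m s :
  admissible h a.+1 b m.+1 (0 :: s) = admissible h a.+1 b.+1 m s.
Proof.
have sorted0 : sorted leq (0 :: s) = sorted leq s by case: s.
rewrite /admissible sorted0 /= !addSn !addnS eqSS.
pose g e := (a + b + count (fun v => v < e.+1) s).+1.
by rewrite !(@iter_semiconj _ _ _ g succn) // => e; rewrite /g /= add1n addnS.
Qed.

Lemma admissible0r h b m s :
  admissible h.+1 0 b m s = admissible h b 0 m s.
Proof.
rewrite /admissible iterSr !addn0 !add0n.
by under [in count _ s]eq_count do rewrite ltn0; rewrite count_pred0 addn0.
Qed.

Lemma mem_words h a b m s : (s \in words h a b m) = admissible h a b m s.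
Proof.
elim: h a b m s => [|h IHh] a b m s.
  have eq_a : (a == a + b + m) = (b == 0) && (m == 0) by lia.
  rewrite /admissible /= {}eq_a.
  case: b m => [|b] [|m] /=; rewrite ?in_nil ?andbF ?inE //.
  by rewrite size_eq0; case: s.
elim: m a b s => [|m IHm] a b s.
  by rewrite inE /admissible; case: s => [|v s]; rewrite /= ?eqxx.
elim: a s => [|a IHa] s; first by rewrite wordsS0 IHh admissible0r.
rewrite wordsSS mem_cat; case: s => [|[|v] s].
- apply/norP; split; apply/mapP => -[t] //.
  by rewrite IHa => /and4P[/eqP + _ _ _]; case: t.
- rewrite admissible_cons0 -IHm mem_map => [|? ? [] //].
  by rewrite orbC; case: mapP => // -[[]].
- case: mapP => [[]//|_] /=.
  case sorted_s: (sorted leq (v.+1 :: s)); last first.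
    rewrite /admissible sorted_s andbF; apply/mapP => -[t].
    rewrite IHa => /and4P[_ sorted_t _ _] def_s.
    by rewrite def_s sorted_succ sorted_t in sorted_s.
  (* A sorted list with positive head contains no 0, so every entry can be lowered by one. *)
  have -> : v.+1 :: s = [seq u.+1 | u <- v :: map predn s].
    rewrite /= -map_comp map_id_in // => -[|u] // s_u.
    by have /allP/(_ 0 s_u) := order_path_min leq_trans sorted_s.
  by rewrite admissible_succ -IHa mem_map //; apply/inj_map/succn_inj.
Qed.

Lemma uniq_words h a b m : uniq (words h a b m).
Proof.
elim: h a b m => [|h IHh] a b m /=; first by case: ifP.
elim: m a b => [|m IHm] a b //; elim: a => [|a IHa]; first exact: IHh.
rewrite -/(words h.+1 a.+1 b m.+1) wordsSS cat_uniq.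
rewrite !map_inj_uniq ?IHm ?IHa ?andbT //=; last 2 first.
- exact/inj_map/succn_inj.
- by move=> s t [].
by apply/hasPn => _ /mapP[[|v s] _ ->]; apply/mapP => -[].
Qed.

(** * Forbidden subposets and nested down-sets and up-sets *)

Lemma partial_orderP (T : finType) (le : rel T) :
  reflect [/\ reflexive le, antisymmetric le & transitive le] (partial_order le).
Proof.
apply: (iffP and3P) => [[/forallP le_refl /forallP le_anti /forallP le_tr]|].
  split=> // [x y le_xy | y x z le_xy le_yz].
    by have /forallP/(_ y)/implyP/(_ le_xy)/eqP := le_anti x.
  have /forallP/(_ y)/forallP/(_ z)/implyP := le_tr x.
  by apply; rewrite le_xy.
move=> [le_refl le_anti le_tr]; split; apply/forallP => x //.
  by apply/forallP => y; apply/implyP => /le_anti ->.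
apply/forallP => y; apply/forallP => z; apply/implyP => /andP[].
exact: le_tr.
Qed.

(** Injectivity is automatic: elements with equal images are related both ways in [leQ]. *)
Lemma has_induced_subposetP (Q T : finType) (leQ : rel Q) (le : rel T) :
    reflexive le -> antisymmetric leQ ->
  reflect (exists f : Q -> T, forall a b, leQ a b = le (f a) (f b))
          (has_induced_subposet leQ le).
Proof.
move=> le_refl leQ_anti; apply: (iffP existsP) => [[f /andP[_ fP]] | [f fP]].
  by exists f => a b; have /forallP/(_ a)/forallP/(_ b)/eqP := fP.
exists (finfun f); apply/andP; split.
  apply/injectiveP => a b; rewrite !ffunE => eq_f.
  by apply: leQ_anti; rewrite !fP eq_f le_refl.
by apply/forallP => a; apply/forallP => b; rewrite !ffunE fP.
Qed.

Lemma disjoint_union_chain_anti k l :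
  antisymmetric (disjoint_union_le (@chain_le k) (@chain_le l)).
Proof.
by move=> [x|x] [y|y] //= eq_xy; congr (_ _); apply/val_inj/anti_leq.
Qed.

(* Asymmetry instead of [x != y] makes [slt] a function of [le] alone, so that
   order embeddings transport it directly. *)
Definition slt (T : finType) (le : rel T) : rel T :=
  fun x y => le x y && ~~ le y x.

Section PartialOrder.
Variables (T : finType) (le : rel T).
Hypothesis le_po : partial_order le.

Let le_refl : reflexive le. Proof. by case/partial_orderP: le_po. Qed.
Let le_anti : antisymmetric le. Proof. by case/partial_orderP: le_po. Qed.
Let le_trans : transitive le. Proof. by case/partial_orderP: le_po. Qed.

Lemma slt_le_trans x y z : slt le x y -> le y z -> slt le x z.
Proof.
move=> /andP[le_xy not_yx] le_yz; rewrite /slt (le_trans le_xy le_yz) /=.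
by apply: contra not_yx => /(le_trans le_yz).
Qed.

Lemma le_slt_trans x y z : le x y -> slt le y z -> slt le x z.
Proof.
move=> le_xy /andP[le_yz not_zy]; rewrite /slt (le_trans le_xy le_yz) /=.
by apply: contra not_zy => /le_trans/(_ le_xy).
Qed.

Lemma sltW x y : slt le x y -> le x y. Proof. by case/andP. Qed.

Lemma slt_neqAle x y : le x y = (x == y) || slt le x y.
Proof.
rewrite /slt; case: eqVneq => [-> | neq_xy]; first by rewrite le_refl.
case le_xy: (le x y) => //=; apply/esym/negP => le_yx.
by case/eqP: neq_xy; apply: le_anti; rewrite le_xy.
Qed.

Lemma slt_trans : transitive (slt le).
Proof. by move=> y x z lt_xy /sltW; apply: slt_le_trans. Qed.

(** Excluding [a < d] and [c < b] already excludes every comparability between the two chains, since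
    any other one composes with [a < b] or [c < d] to one of these. *)
Lemma free22P :
  reflect (forall a b c d, slt le a b -> slt le c d -> slt le a d || slt le c b)
    (~~ has_induced_subposet (disjoint_union_le (@chain_le 2) (@chain_le 2)) le).
Proof.
apply: (iffP negP) => [free a b c d lt_ab lt_cd | free22].
  apply/negP => /negP; rewrite negb_or => /andP[/negP not_ad /negP not_cb].
  case: free; apply/(has_induced_subposetP le_refl).
    exact: disjoint_union_chain_anti.
  exists (fun u : 'I_2 + 'I_2 => match u with
    | inl i => nth a [:: a; b] i | inr i => nth c [:: c; d] i end).
  have [le_ab /negbTE nle_ba] := andP lt_ab.
  have [le_cd /negbTE nle_dc] := andP lt_cd.
  have nac : le a c = false.
    by apply/negP => /le_slt_trans/(_ lt_cd).
  have nbd : le b d = false by apply/negP => /(slt_le_trans lt_ab).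
  have nca : le c a = false by apply/negP => /le_slt_trans/(_ lt_ab).
  have ndb : le d b = false by apply/negP => /(slt_le_trans lt_cd).
  have nbc : le b c = false by apply/negP => /le_trans/(_ le_cd); rewrite nbd.
  have nda : le d a = false by apply/negP => /le_trans/(_ le_ab); rewrite ndb.
  have nad : le a d = false.
    by apply/negP => le_ad; case: not_ad; rewrite /slt le_ad nda.
  have ncb : le c b = false.
    by apply/negP => le_cb; case: not_cb; rewrite /slt le_cb nbc.
  by move=> [[[|[|//]] ?]|[[|[|//]] ?]] [[[|[|//]] ?]|[[|[|//]] ?]];
     rewrite /= /chain_le /= ?le_refl.
case/(has_induced_subposetP le_refl (@disjoint_union_chain_anti _ _)).
move=> f fP.
have := free22 (f (inl ord0)) (f (inl ord_max))
  (f (inr ord0)) (f (inr ord_max)).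
by rewrite /slt -!fP /chain_le /=; move=> /(_ isT isT).
Qed.

Lemma free31P :
  reflect (forall a b c d, slt le a b -> slt le b c -> slt le a d || slt le d c)
    (~~ has_induced_subposet (disjoint_union_le (@chain_le 3) (@chain_le 1)) le).
Proof.
apply: (iffP negP) => [free a b c d lt_ab lt_bc | free31].
  apply/negP => /negP; rewrite negb_or => /andP[/negP not_ad /negP not_dc].
  case: free; apply/(has_induced_subposetP le_refl).
    exact: disjoint_union_chain_anti.
  exists (fun u : 'I_3 + 'I_1 => match u with
    | inl i => nth a [:: a; b; c] i | inr i => d end).
  have lt_ac := slt_trans lt_ab lt_bc.
  have [le_ab /negbTE nle_ba] := andP lt_ab.
  have [le_bc /negbTE nle_cb] := andP lt_bc.
  have [le_ac /negbTE nle_ca] := andP lt_ac.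
  have nbd : le b d = false by apply/negP => /(slt_le_trans lt_ab).
  have ncd : le c d = false by apply/negP => /(slt_le_trans lt_ac).
  have nda : le d a = false by apply/negP => /le_slt_trans/(_ lt_ac).
  have ndb : le d b = false by apply/negP => /le_slt_trans/(_ lt_bc).
  have nad : le a d = false.
    by apply/negP => le_ad; case: not_ad; rewrite /slt le_ad nda.
  have ndc : le d c = false.
    by apply/negP => le_dc; case: not_dc; rewrite /slt le_dc ncd.
  by move=> [[[|[|[|//]]] ?]|[[|//] ?]] [[[|[|[|//]]] ?]|[[|//] ?]];
     rewrite /= /chain_le /= ?le_refl.
case/(has_induced_subposetP le_refl (@disjoint_union_chain_anti _ _)).
move=> f fP.
have := free31 (f (inl ord0)) (f (inl (Ordinal (isT : 1 < 3))))
  (f (inl ord_max)) (f (inr ord0)).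
by rewrite /slt -!fP /chain_le /=; move=> /(_ isT isT).
Qed.

Definition down x : {set T} := [set y | slt le y x].
Definition up x : {set T} := [set y | slt le x y].
(** Complementing the up-set makes both summands grow with height, so one number can sort by both
    inclusions. *)
Definition height_key x := #|down x| + #|~: up x|.

(** Without 2+2, down-sets are nested and so are up-sets; without 3+1, a failed inclusion of
    down-sets forces the inclusion of up-sets in the same direction. Hence a failure of either
    conclusion makes one summand of the key of [x] strictly larger and the other no smaller. *)
Lemma height_keyP x y :
    ~~ has_induced_subposet (disjoint_union_le (@chain_le 2) (@chain_le 2)) le ->
    ~~ has_induced_subposet (disjoint_union_le (@chain_le 3) (@chain_le 1)) le ->
    height_key x <= height_key y ->
  (down x \subset down y) /\ (up y \subset up x).
Proof.
move=> /free22P free22 /free31P free31 le_key.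
have chain_down u v : (down u \subset down v) || (down v \subset down u).
  case: subsetP => // /subsetP/subsetPn[a]; rewrite !inE => lt_au not_av.
  apply/subsetP => c; rewrite !inE => /(free22 _ _ _ _ lt_au).
  by rewrite (negbTE not_av).
have chain_up u v : (up u \subset up v) || (up v \subset up u).
  case: subsetP => // /subsetP/subsetPn[a]; rewrite !inE => lt_ua not_va.
  apply/subsetP => c; rewrite !inE => /(free22 _ _ _ _ lt_ua).
  by rewrite (negbTE not_va) orbF.
have mixed u v : (down u \subset down v) || (up u \subset up v).
  case: subsetP => // /subsetP/subsetPn[a]; rewrite !inE => lt_au not_av.
  apply/subsetP => c; rewrite !inE => /(free31 _ _ _ v lt_au).
  by rewrite (negbTE not_av).
split; apply: contraLR le_key => not_sub; rewrite -ltnNge.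
  have := mixed x y; have := chain_down x y; rewrite (negbTE not_sub) /=.
  move=> sub_down sub_up; rewrite -addSn leq_add //.
    by rewrite proper_card // properE sub_down.
  by rewrite subset_leq_card // setCS.
have := mixed y x; have := chain_up y x; rewrite (negbTE not_sub) orbF /=.
move=> sub_up sub_down; rewrite -addnS leq_add //; first exact: subset_leq_card.
by rewrite proper_card // properE !setCS sub_up.
Qed.

End PartialOrder.

(** * Initial segments, isomorphism and counting in sorted lists *)

Lemma card_ltn_ord n c : c <= n -> #|[set i : 'I_n | i < c]| = c.
Proof.
move=> le_cn; rewrite -sum1_card; under eq_bigl do rewrite inE.
by rewrite (big_ord_narrow le_cn) sum1_card card_ord.
Qed.

(** A down-closed set contains the [i.+1] indices up to any member [i] and lies strictly below any
    nonmember. *)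
Lemma mem_initial_segment n (A : {set 'I_n}) (i : 'I_n) :
    (forall j k : 'I_n, j <= k -> k \in A -> j \in A) ->
  (i \in A) = (i < #|A|).
Proof.
move=> A_down; apply/idP/idP => [A_i | ].
  rewrite -(card_ltn_ord (ltn_ord i)); apply/subset_leq_card/subsetP => j.
  by rewrite inE ltnS => /A_down; apply.
apply: contraLR => not_Ai; rewrite -leqNgt.
rewrite -(card_ltn_ord (ltnW (ltn_ord i))).
apply/subset_leq_card/subsetP => j A_j; rewrite inE ltnNge.
by apply: contra not_Ai => /A_down; apply.
Qed.

Lemma isomorphicP (T : finType) (le1 le2 : rel T) :
  reflect (exists s : {perm T}, forall x y, le1 x y = le2 (s x) (s y))
          (isomorphic le1 le2).
Proof.
apply: (iffP existsP) => -[s iso_s]; exists s.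
  move=> x y; by have /forallP/(_ x)/forallP/(_ y)/eqP := iso_s.
by apply/forallP => x; apply/forallP => y; rewrite iso_s.
Qed.

Lemma isomorphic_refl (T : finType) : reflexive (@isomorphic T).
Proof. by move=> le; apply/isomorphicP; exists 1%g => x y; rewrite !perm1. Qed.

Lemma isomorphic_sym (T : finType) : symmetric (@isomorphic T).
Proof.
move=> le1 le2; apply/isomorphicP/isomorphicP => -[s iso_s];
  by exists s^-1%g => x y; rewrite iso_s !permKV.
Qed.

Lemma isomorphic_trans (T : finType) : transitive (@isomorphic T).
Proof.
move=> le2 le1 le3 /isomorphicP[s iso_s] /isomorphicP[t iso_t].
by apply/isomorphicP; exists (s * t)%g => x y; rewrite iso_s iso_t !permM.
Qed.

Lemma isomorphic_length (T : finType) (le1 le2 : rel T) :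
  isomorphic le1 le2 -> poset_length le1 <= poset_length le2.
Proof.
move=> /isomorphicP[s iso_s]; apply/bigmax_leqP => C chain_C.
rewrite -(card_imset _ (@perm_inj _ s)).
apply: (@leq_bigmax_cond _ (is_chain le2) (fun D : {set T} => #|D|.-1)).
apply/forallP => x; apply/implyP => /imsetP[u C_u ->].
apply/forallP => y; apply/implyP => /imsetP[v C_v ->].
rewrite -!iso_s; have /forallP/(_ u)/implyP/(_ C_u) := chain_C.
by move=> /forallP/(_ v)/implyP/(_ C_v).
Qed.

(** The entries at most [c] form a prefix of a sorted list. *)
Lemma ltn_count_sorted c s i :
  sorted leq s -> i < size s -> (i < count (leq^~ c) s) = (nth 0 s i <= c).
Proof.
elim: s i => // v s IHs i sorted_vs lt_i /=.
have /allP ge_v := order_path_min leq_trans sorted_vs.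
have sorted_s := path_sorted sorted_vs.
case: (leqP v c) => [le_vc | lt_cv]; first by case: i lt_i => // i; apply: IHs.
have -> : count (leq^~ c) s = 0.
  rewrite (@eq_in_count _ _ pred0) ?count_pred0 // => u /ge_v le_vu /=.
  by apply/negbTE; rewrite -ltnNge (leq_trans lt_cv).
case: i lt_i => [|i] lt_i /=; apply/esym/negbTE; rewrite -ltnNge //.
by rewrite (leq_trans lt_cv) // ge_v // mem_nth.
Qed.

(** * Canonical semiorders and their length *)

Definition canon n (g : seq nat) : {set 'I_n * 'I_n} :=
  [set p : 'I_n * 'I_n | (p.1 == p.2) || (p.1 < nth 0 g p.2)].

Section Canonical.
Variables (n : nat) (g : seq nat).

Definition canon_le : rel 'I_n := rel_of (canon n g).

Lemma canon_leE x y : canon_le x y = (x == y) || (x < nth 0 g y).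
Proof. by rewrite /canon_le /rel_of inE. Qed.

Hypotheses (size_g : size g = n) (sorted_g : sorted leq g).
Hypothesis bounded_g : bounded 1 g.

Let g_le (i : 'I_n) : nth 0 g i <= i.
Proof. by apply: (boundedP _ _ bounded_g); rewrite size_g. Qed.

Let g_homo (i j : nat) : i <= j -> j < n -> nth 0 g i <= nth 0 g j.
Proof.
move=> le_ij lt_jn; apply: (sorted_leq_nth leq_trans leqnn) => //.
  by rewrite inE size_g (leq_ltn_trans le_ij).
by rewrite inE size_g.
Qed.

Lemma slt_canon x y : slt canon_le x y = (x < nth 0 g y).
Proof.
rewrite /slt !canon_leE; case: eqVneq => [-> | neq_xy] /=.
  by rewrite ltnNge g_le.
have := g_le x; have := g_le y.
by case: ltnP => //=; lia.
Qed.

Lemma canon_po : partial_order canon_le.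
Proof.
apply/partial_orderP; split => [x | x y | y x z]; rewrite !canon_leE.
- by rewrite eqxx.
- have := g_le x; have := g_le y.
  by case: eqVneq => //= _; lia.
- have := g_le y; case: eqVneq => [-> // | _ /=].
  case: eqVneq => [<- _ -> | _ le_gy lt_x lt_y]; first by rewrite orbT.
  by apply/orP; right; lia.
Qed.

(** Down-sets are initial segments. For 2+2, the larger of those of [b] and [d] contains both [a]
    and [c]. For 3+1, if [d] is not below [c], then [b] precedes [d] in index, and monotonicity of
    [g] puts [a] below [d]. *)
Lemma canon_semiorder : semiorder canon_le.
Proof.
apply/and3P; split; first exact: canon_po.
  apply/(free22P canon_po) => a b c d; rewrite !slt_canon => lt_ab lt_cd.
  case: (leqP (nth 0 g b) (nth 0 g d)) => [le_bd | /ltnW le_db].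
    by rewrite (leq_trans lt_ab).
  by rewrite (leq_trans lt_cd) ?orbT.
apply/(free31P canon_po) => a b c d; rewrite !slt_canon => lt_ab lt_bc.
case: (ltnP d (nth 0 g c)) => [_ | le_cd]; first by rewrite orbT.
rewrite (leq_trans lt_ab) // g_homo //; exact: leq_trans (ltnW lt_bc) le_cd.
Qed.

Lemma card_down_canon x : #|down canon_le x| = nth 0 g x.
Proof.
rewrite -[RHS](@card_ltn_ord n) ?(leq_trans (g_le x)) 1?ltnW //.
by apply: eq_card => y; rewrite !inE slt_canon.
Qed.

Let phi c := count (leq^~ c) g.

(* The iterates of [phi] from 0 are the ends of the levels.  Consecutive ends
   form a chain as long as they stay below [n]; conversely, removing its maximum
   from a chain moves it down one level. *)
Lemma canon_length h :
  (poset_length canon_le <= h) = (iter h.+1 phi 0 == n).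
Proof.
have phi_le c : phi c <= n by rewrite -size_g count_size.
have mem_phi i c : i < n -> (i < phi c) = (nth 0 g i <= c).
  by move=> lt_in; rewrite ltn_count_sorted ?size_g.
apply/bigmax_leqP/eqP => [short | full C chain_C].
  apply/eqP; rewrite eqn_leq phi_le leqNgt; apply/negP => lt_n.
  have mono k : iter k phi 0 <= iter k.+1 phi 0.
    elim: k => // k IHk; apply: sub_count => v /=.
    by move/leq_trans; apply.
  have {}mono := homo_leq leqnn leq_trans mono.
  have lt_top k : k <= h.+1 -> iter k phi 0 < n by move=> /mono/leq_ltn_trans; apply.
  have step k : k < h.+1 -> iter k phi 0 < nth 0 g (iter k.+1 phi 0).
    by move=> lt_k; rewrite ltnNge -mem_phi ?lt_top //= ltnn.
  have step_lt k : k < h.+1 -> iter k phi 0 < iter k.+1 phi 0.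
    move=> lt_k; apply: leq_trans (step k lt_k) _.
    exact: (g_le (Ordinal (lt_top _ lt_k))).
  (* These are the first elements of the levels 0 to [h.+1]; by [step] they form a chain of length
     [h.+1], one too many. *)
  pose x (k : 'I_h.+2) := Ordinal (lt_top k (ltn_ord k)).
  have x_lt (j k : 'I_h.+2) : j < k -> canon_le (x j) (x k).
    case: k => -[|k] //= lt_k; rewrite ltnS => le_jk; rewrite canon_leE; apply/orP; right => /=.
    by apply: leq_ltn_trans (mono _ _ le_jk) _; apply: step.
  have x_inj : injective x.
    move=> j k /(congr1 val) /= eq_jk; apply/val_inj/eqP.
    have aux (u v : 'I_h.+2) : u < v -> iter u phi 0 < iter v phi 0.
      case: v => -[|v] //= lt_v; rewrite ltnS => le_uv.
      by apply: leq_ltn_trans (mono _ _ le_uv) _; apply: step_lt.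
    by case: ltngtP => // /aux; rewrite eq_jk ltnn.
  have := short [set x k | k : 'I_h.+2].
  rewrite card_imset // card_ord /= ltnn => not_chain.
  suff /not_chain : is_chain canon_le [set x k | k : 'I_h.+2] by [].
  apply/forallP => u; apply/implyP => /imsetP[j _ ->].
  apply/forallP => v; apply/implyP => /imsetP[k _ ->].
  case: (ltngtP j k) => [/x_lt-> // | /x_lt -> | /val_inj ->].
    by rewrite orbT.
  by rewrite canon_leE eqxx.
rewrite -subn1 leq_subLR add1n.
have bound k (D : {set 'I_n}) : is_chain canon_le D ->
    (forall x, x \in D -> x < iter k phi 0) -> #|D| <= k.
  elim: k D => [|k IHk] D chain_D D_lt.
    rewrite leqn0 cards_eq0; apply/eqP/setP => x; rewrite inE.
    by apply/negP => /D_lt.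
  have [-> | [x0 D_x0]] := set_0Vmem D; first by rewrite cards0.
  case: (@arg_maxnP _ x0 (mem D) val D_x0) => x /= D_x x_max.
  rewrite (cardsD1 x) [x \in D]D_x add1n ltnS; apply: IHk => [|y].
    apply/forallP => u; apply/implyP => /setD1P[_ D_u].
    apply/forallP => v; apply/implyP => /setD1P[_ D_v].
    by have /forallP/(_ u)/implyP/(_ D_u)/forallP/(_ v)/implyP/(_ D_v) := chain_D.
  case/setD1P=> neq_yx D_y.
  have /forallP/(_ x)/implyP/(_ D_x)/forallP/(_ y)/implyP/(_ D_y) := chain_D.
  have := D_lt x D_x; rewrite iterS mem_phi // => le_gx.
  rewrite !canon_leE (negbTE neq_yx) eq_sym (negbTE neq_yx) /=.
  (* The alternative [x < g_y <= y] contradicts the choice of [x], so [y < g_x], which is at most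
     the preceding level end. *)
  have := x_max y D_y; have := g_le y; move: le_gx; rewrite /=; lia.
by apply: bound chain_C _ => x _; rewrite full.
Qed.

End Canonical.

(** * Existence and uniqueness of the canonical sequence *)

(** Once the elements are sorted by [height_key], every down-set is an initial segment of the list,
    so its size determines it. *)
Lemma canon_exists n (le : rel 'I_n) : semiorder le ->
  exists g, [/\ size g = n, sorted leq g, bounded 1 g &
                isomorphic le (@canon_le n g)].
Proof.
case/and3P=> po free22 free31.
have key_mono x y := @height_keyP _ le po x y free22 free31.
pose key := height_key le; pose xs := sort (relpre key leq) (enum 'I_n).
have size_xs : size xs = n by rewrite size_sort -cardE card_ord.
have uniq_xs : uniq xs by rewrite sort_uniq enum_uniq.
(* As ['I_n] may be empty, the index serves as its own default value. *)
have s_inj : injective (fun i : 'I_n => nth i xs i).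
  move=> i j; rewrite (set_nth_default i j) ?size_xs // => /eqP.
  by rewrite nth_uniq ?size_xs // => /eqP/val_inj.
pose s := perm s_inj; have sE (i0 i : 'I_n) : s i = nth i0 xs i.
  by rewrite permE; apply: set_nth_default; rewrite size_xs.
have sorted_xs : sorted (relpre key leq) xs.
  by apply: sort_sorted => x y; apply: leq_total.
have key_s (i j : 'I_n) : i <= j -> key (s i) <= key (s j).
  move=> le_ij; rewrite !(sE i).
  have key_trans : transitive (relpre key leq) by move=> y x z; apply: leq_trans.
  have key_refl : reflexive (relpre key leq) by move=> x; apply: leqnn.
  by apply: (sorted_leq_nth key_trans key_refl); rewrite ?inE ?size_xs.
pose g := [seq #|down le x| | x <- xs].
have gE (i : 'I_n) : nth 0 g i = #|down le (s i)|.
  by rewrite (nth_map i) ?size_xs // (sE i).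
have ltE (i j : 'I_n) : slt le (s i) (s j) = (i < nth 0 g j).
  have memE k : (k \in [set s^-1%g x | x in down le (s j)]) = slt le (s k) (s j).
    by rewrite -{1}[k](permK s) mem_imset ?inE //; apply: perm_inj.
  rewrite gE -(card_imset _ (@perm_inj _ s^-1%g)) -mem_initial_segment ?memE //.
  (* The earlier of two elements has the larger up-set, so whatever lies above the later one lies
     above it too. *)
  move=> k l le_kl; rewrite !memE.
  have [_ /subsetP/(_ (s j))] := key_mono _ _ (key_s _ _ le_kl).
  by rewrite !inE.
exists g; split.
- by rewrite size_map.
- apply: homo_sorted sorted_xs => x y /= /key_mono[sub_xy _].
  exact: subset_leq_card.
- apply/boundedP => i; rewrite size_map size_xs add1n ltnS => lt_in.
  (* Irreflexivity of the strict order gives the bound: an element is not in its own down-set. *)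
  have := ltE (Ordinal lt_in) (Ordinal lt_in).
  by rewrite /slt andbN /= => not_lt; rewrite leqNgt -not_lt.
- rewrite isomorphic_sym; apply/isomorphicP; exists s => i j.
  by rewrite canon_leE (slt_neqAle po) ltE (inj_eq perm_inj).
Qed.

(** The sequence is the sorted list of down-set sizes, and an isomorphism preserves these sizes with
    multiplicity. *)
Lemma canon_inj n g1 g2 :
    size g1 = n -> sorted leq g1 -> bounded 1 g1 ->
    size g2 = n -> sorted leq g2 -> bounded 1 g2 ->
  isomorphic (@canon_le n g1) (@canon_le n g2) -> g1 = g2.
Proof.
move=> size1 sort1 bnd1 size2 sort2 bnd2 /isomorphicP[s iso_s].
have gE g : size g = n -> sorted leq g -> bounded 1 g ->
    g = [seq #|down (@canon_le n g) x| | x <- enum 'I_n].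
  move=> size_g sort_g bnd_g; apply: (@eq_from_nth _ 0) => [|i].
    by rewrite size_map -cardE card_ord.
  rewrite size_g => lt_in; pose j := Ordinal lt_in.
  rewrite (nth_map j) ?size_enum_ord // -[i]/(nat_of_ord j).
  by rewrite (nth_ord_enum j j) card_down_canon.
apply: (sorted_eq leq_trans anti_leq) => //.
rewrite [X in perm_eq X _]gE // [X in perm_eq _ X]gE //.
have -> : [seq #|down (@canon_le n g1) x| | x <- enum 'I_n]
    = [seq #|down (@canon_le n g2) x| | x <- [seq s x | x <- enum 'I_n]].
  rewrite -map_comp; apply: eq_map => x /=.
  rewrite -[LHS](card_imset _ (@perm_inj _ s)); apply: eq_card => z.
  by rewrite -[z](permKV s) (mem_imset _ _ perm_inj) !inE /slt !iso_s.
apply/perm_map/uniq_perm; rewrite ?(map_inj_uniq perm_inj) -?enumT ?enum_uniq //.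
move=> y; rewrite mem_enum; apply/mapP; exists (s^-1 y)%g; rewrite ?mem_enum //.
by rewrite permKV.
Qed.

(** * Counting isomorphism classes and the recursion *)

Lemma mem_words_canon h n g :
  reflect [/\ size g = n, sorted leq g, bounded 1 g &
              poset_length (@canon_le n g) <= h] (g \in words h.+1 1 0 n).
Proof.
(* The virtual root occupies position 0, so level ends among all nodes exceed those among the
   elements by one. *)
have heightE : (iter h.+1 (fun e => 1 + 0 + count (fun v => v < e) g) 1 == 1 + 0 + n)
    = (iter h.+1 (fun c => count (leq^~ c) g) 0 == n).
  by rewrite (@iter_semiconj _ _ _ (fun c => count (leq^~ c) g) succn).
rewrite mem_words /admissible heightE.
apply: (iffP and4P) => [[/eqP size_g sorted_g bnd_g height_g] | [size_g sorted_g bnd_g]].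
  by split=> //; rewrite canon_length.
by rewrite canon_length // => ->; rewrite size_g eqxx.
Qed.

Lemma num_semiordersE h n : num_semiorders h n = size (words h.+1 1 0 n).
Proof.
pose R (S1 S2 : {set 'I_n * 'I_n}) := isomorphic (rel_of S1) (rel_of S2).
(* The partition is by definition the image of [block]; it is matched with the duplicate-free list
   of blocks of canonical semiorders. *)
pose block S := [set S' in semiorders_upto h n | R S S'].
pose classes := [seq block (canon n g) | g <- words h.+1 1 0 n].
have canon_in g : g \in words h.+1 1 0 n -> canon n g \in semiorders_upto h n.
  move=> /mem_words_canon[size_g sorted_g bnd_g length_g].
  by rewrite inE canon_semiorder.
have uniq_classes : uniq classes.
  rewrite map_inj_in_uniq ?uniq_words // => g1 g2 W_g1 W_g2 eq_block.
  have: canon n g2 \in block (canon n g2).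
    by rewrite inE canon_in // /R isomorphic_refl.
  rewrite -eq_block inE => /andP[_].
  have [? ? ? _] := mem_words_canon _ _ _ W_g1.
  by have [? ? ? _] := mem_words_canon _ _ _ W_g2; apply: canon_inj.
rewrite -(size_map (fun g => block (canon n g))) -(card_uniqP uniq_classes).
apply: eq_card => B; apply/imsetP/mapP => [[S D_S ->] | [g W_g ->]]; last first.
  by exists (canon n g); rewrite ?canon_in.
have /andP[semi_S length_S] : semiorder (rel_of S) && (poset_length (rel_of S) <= h).
  by rewrite inE in D_S.
have [g [size_g sorted_g bnd_g iso_g]] := canon_exists semi_S.
exists g.
  apply/mem_words_canon; split=> //; apply: leq_trans length_S.
  by apply: isomorphic_length; rewrite isomorphic_sym.
apply/setP => S'; rewrite !inE; congr (_ && _).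
apply/idP/idP; apply: isomorphic_trans => //.
by rewrite isomorphic_sym.
Qed.

Theorem theorem4p1 :
  (forall h : nat, num_semiorders h 0 = 1) /\
  (forall n h : nat, 2 <= n -> 1 <= h ->
     num_semiorders h n =
     \sum_(0 <= t < n) num_semiorders h t * num_semiorders (h - 1) (n - 1 - t)).
Proof.
split=> [h | [//|n] [//|h] _ _]; first by rewrite num_semiordersE.
(* With no node waiting, no further node can be attached; so the first entry must be a child of the
   virtual root. *)
have words00 k : words k 0 0 n.+1 = [::] by elim: k => // k; rewrite wordsS0.
(* The groups are the root, still on the current level with its later children to come, and its
   first child, on the next level and hence with one level fewer below it. *)
rewrite num_semiordersE size_wordsSS words00 addn0 (size_words_conv _ 1 0 0 1).
rewrite big_mkord !subSS !subn0.
by apply: eq_bigr => t _; rewrite !num_semiordersE wordsS0.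
Qed.
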